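(* Let $m\ge2$ and let $F$ be the free group $\mathbb F_m$ on $m$ free generators, expanded by predicates for all subsets of $\mathbb F_m$. Let $F^*\succ F$ be a monster model. Then ${F^*}^{000}_F={F^*}^{000}_\emptyset\ne{F^*}^{00}_\emptyset={F^*}^{00}_F$.
   Context: A monster model $F^*\succ F$ is a $\kappa$-saturated, strongly $\kappa$-homogeneous elementary extension for a sufficiently large cardinal $\kappa$; ''small'' and ''bounded'' mean of cardinality $<\kappa$. For a small set $B$ of parameters, ${F^*}^{00}_B$ is the smallest subgroup of (the group) $F^*$ of bounded index which is type-definable over $B$, and ${F^*}^{000}_B$ is the smallest subgroup of $F^*$ of bounded index which is invariant under $\mathrm{Aut}(F^*/B)$. The subscript $F$ means that $B=F$ is the set of elements of the original structure, viewed as a subset of $F^*$. *)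

(* Defs.v *)
From HB Require Import structures.
From mathcomp Require Import all_boot.
From mathcomp Require Import boolp classical_sets functions cardinality.

Set Implicit Arguments.
Unset Strict Implicit.
Unset Printing Implicit Defensive.

Local Open Scope classical_set_scope.
Local Open Scope card_scope.

(******************************************************************************)
(* Free groups as groups of reduced words. The letter (i, true) is the i-th   *)
(* generator and (i, false) is its inverse.                                   *)
(******************************************************************************)

Section FreeGroup.
Variable m : nat.

Definition letter := ('I_m * bool)%type.
Definition letter_inv (x : letter) : letter := (x.1, ~~ x.2).

Definition reduced (w : seq letter) : bool :=
  sorted (fun x y => y != letter_inv x) w.

(* left multiplication of a reduced word by a letter *)
Definition push (x : letter) (w : seq letter) : seq letter :=
  if w is y :: w' then if y == letter_inv x then w' else x :: w else [:: x].

Definition word_mul (u v : seq letter) : seq letter := foldr push v u.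
Definition word_inv (u : seq letter) : seq letter := rev (map letter_inv u).

Lemma letter_invK : involutive letter_inv.
Proof. by case=> i b; rewrite /letter_inv /= negbK. Qed.

Lemma reduced_push x w : reduced w -> reduced (push x w).
Proof.
case: w => [|y w] //= ryw; case: ifPn => [_|ne_yx] /=; last by rewrite ne_yx.
by case: w ryw => [|z w] //= /andP[].
Qed.

Lemma reduced_mul u v : reduced v -> reduced (word_mul u v).
Proof. by move=> rv; elim: u => //= x u; apply: reduced_push. Qed.

Lemma reduced_inv u : reduced u -> reduced (word_inv u).
Proof.
rewrite /reduced /word_inv rev_sorted sorted_map; apply: sub_sorted => x y /=.
by rewrite letter_invK; apply: contraNneq => <-.
Qed.

Lemma pushK x w : reduced w -> push (letter_inv x) (push x w) = w.
Proof.
case: w => [|y w] /=; first by rewrite letter_invK eqxx.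
case: (eqVneq y (letter_inv x)) => [->|_] /= rw; last by rewrite letter_invK eqxx.
by case: w rw => [|z w] //= /andP[/negPf ->].
Qed.

Lemma word_mul_push x v w : reduced v -> reduced w ->
  word_mul (push x v) w = push x (word_mul v w).
Proof.
case: v => [|y v] //= rv rw; case: ifP => // /eqP ->.
have := @pushK (letter_inv x) (word_mul v w) (reduced_mul v rw).
by rewrite letter_invK.
Qed.

Lemma word_mulA u v w : reduced v -> reduced w ->
  word_mul u (word_mul v w) = word_mul (word_mul u v) w.
Proof.
move=> rv rw; elim: u => //= x u ->.
by rewrite word_mul_push // reduced_mul.
Qed.

Lemma word_mulw1 u : reduced u -> word_mul u [::] = u.
Proof.
elim: u => //= x u IHu rxu; rewrite IHu; last exact: path_sorted rxu.
by case: u rxu {IHu} => [|y u] //= /andP[/negPf ->].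
Qed.

Lemma word_mulVw u : word_mul (word_inv u) u = [::].
Proof.
suff mulVcat v : reduced v -> word_mul (word_inv u) (word_mul u v) = v.
  elim: u {mulVcat} => //= x u IHu.
  rewrite /word_inv map_cons rev_cons -cats1 /word_mul foldr_cat /=.
  by rewrite letter_invK eqxx.
rewrite /word_inv; elim: u => //= x u IHu rv.
rewrite rev_cons -cats1 {1}/word_mul foldr_cat /= pushK ?reduced_mul //.
exact: IHu.
Qed.

Lemma word_invK : involutive word_inv.
Proof.
by move=> u; rewrite /word_inv map_rev revK -map_comp map_id_in // => x _ /=;
   rewrite letter_invK.
Qed.

Record free_group := FreeGroup {
  fg_word :> seq letter; fg_reduced : reduced fg_word }.

HB.instance Definition _ := [isSub for fg_word].
HB.instance Definition _ := [Choice of free_group by <:].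

Definition fg_one := @FreeGroup [::] isT.
Definition fg_mul (u v : free_group) :=
  FreeGroup (@reduced_mul u v (fg_reduced v)).
Definition fg_inv (u : free_group) := FreeGroup (reduced_inv (fg_reduced u)).

Lemma fg_mulA : associative fg_mul.
Proof. by move=> u v w; apply: val_inj; apply: word_mulA; apply: fg_reduced. Qed.

Lemma fg_mul1g : left_id fg_one fg_mul.
Proof. by move=> u; apply: val_inj. Qed.

Lemma fg_mulg1 : right_id fg_one fg_mul.
Proof. by move=> u; apply: val_inj; apply: word_mulw1; apply: fg_reduced. Qed.

Lemma fg_mulVg : left_inverse fg_one fg_inv fg_mul.
Proof. by move=> u; apply: val_inj; apply: word_mulVw. Qed.

Lemma fg_mulgV : right_inverse fg_one fg_inv fg_mul.
Proof.
move=> u; apply: val_inj; rewrite /= -{1}[fg_word u]word_invK.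
exact: word_mulVw.
Qed.

HB.instance Definition _ := isGroup.Build free_group
  fg_mulA fg_mul1g fg_mulg1 fg_mulVg fg_mulgV.

End FreeGroup.

(******************************************************************************)
(* First-order logic in the language (1, *, ^-1) of groups expanded by unary  *)
(* predicate symbols indexed by P. Formulas are well-scoped: [form P n] is    *)
(* the type of formulas whose free variables are among n de Bruijn variables. *)
(******************************************************************************)

Inductive term (n : nat) : Type :=
| tvar of 'I_n
| tone
| tmul of term n & term n
| tinv of term n.
Arguments tone {n}.

Inductive form (P : Type) (n : nat) : Type :=
| fbot
| feq of term n & term n
| fpred of P & term n
| fimp of form P n & form P n
| fall of form P n.+1.
Arguments fbot {P n}.
Arguments feq {P n}.

(* No group axioms are required here: elementary extensions of groups satisfy *)
(* them automatically.                                                        *)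
Record structure (P : Type) := Structure {
  dom :> Type;
  sone : dom;
  smul : dom -> dom -> dom;
  sinv : dom -> dom;
  spred : P -> set dom }.
Arguments sone {P s}.
Arguments smul {P s}.
Arguments sinv {P s}.
Arguments spred {P s}.

Definition all_subsets_expansion (G : groupType) : structure (set G) :=
  @Structure (set G) G 1%g (fun x y => x * y)%g (fun x => x^-1)%g (fun A => A).

Section Semantics.
Variables (P : Type) (M : structure P).

(* x becomes the value of the variable ord0 *)
Definition scons (n : nat) (x : M) (v : 'I_n -> M) : 'I_n.+1 -> M :=
  fun i => oapp v x (unlift ord0 i).

Fixpoint teval (n : nat) (v : 'I_n -> M) (t : term n) : M :=
  match t with
  | tvar i => v i
  | tone => sone
  | tmul t1 t2 => smul (teval v t1) (teval v t2)
  | tinv t1 => sinv (teval v t1)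
  end.

Fixpoint sat (n : nat) (phi : form P n) : ('I_n -> M) -> Prop :=
  match phi with
  | fbot => fun=> False
  | feq t1 t2 => fun v => teval v t1 = teval v t2
  | fpred A t => fun v => spred A (teval v t)
  | fimp phi1 phi2 => fun v => sat phi1 v -> sat phi2 v
  | fall phi1 => fun v => forall x : M, sat phi1 (scons x v)
  end.

(* Formulas phi(x, b) in one free variable x (the variable ord0) with a tuple *)
(* b of parameters from B.                                                    *)
Record pform (B : set M) := PForm {
  parity : nat;
  pbody : form P parity.+1;
  pparam : 'I_parity -> M;
  pparamP : forall i, B (pparam i) }.

Definition psat (B : set M) (phi : pform B) (x : M) : Prop :=
  sat (pbody phi) (scons x (@pparam B phi)).

Definition automorphism (f : M -> M) : Prop :=
  [/\ bijective f,
      f sone = sone,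
      forall x y, f (smul x y) = smul (f x) (f y),
      forall x, f (sinv x) = sinv (f x) &
      forall A x, spred A (f x) <-> spred A x].

Definition partial_elementary (A : set M) (f : M -> M) : Prop :=
  forall n (phi : form P n) (v : 'I_n -> M), (forall i, A (v i)) ->
    (sat phi v <-> sat phi (f \o v)).

End Semantics.

Definition elementary_embedding (P : Type) (M N : structure P) (f : M -> N) :
    Prop :=
  forall n (phi : form P n) (v : 'I_n -> M), sat phi v <-> sat phi (f \o v).

(******************************************************************************)
(* A cardinal kappa is represented by a type K of cardinality kappa.          *)
(******************************************************************************)

Definition card_lt (T U : Type) (A : set T) (B : set U) : Prop :=
  (A #<= B) /\ ~ (B #<= A).

Definition small (K T : Type) (A : set T) : Prop := card_lt A [set: K].

(* kappa > 2^|L|, where |L| is the number of formulas of the language; an     *)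
(* explicit bound under which the connected components over a set of at most  *)
(* |L| parameters exist.                                                      *)
Definition sufficiently_large (K P : Type) : Prop :=
  small K [set: set {n : nat & form P n}].

Section Monster.
Variables (K P : Type) (M : structure P).

Definition saturated : Prop :=
  forall A : set M, small K A -> forall p : set (pform A),
    (forall q : set (pform A), finite_set q -> q `<=` p ->
       exists x : M, forall phi, q phi -> psat phi x) ->
    exists x : M, forall phi, p phi -> psat phi x.

Definition strongly_homogeneous : Prop :=
  forall (A : set M) (f : M -> M), small K A -> partial_elementary A f ->
    exists2 g : M -> M, automorphism g & forall x, A x -> g x = f x.

Definition subgroup (H : set M) : Prop :=
  [/\ H sone, forall x y, H x -> H y -> H (smul x y) &
      forall x, H x -> H (sinv x)].

Definition lcosets (H : set M) : set (set M) :=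
  [set [set smul x h | h in H] | x in [set: M]].

Definition bounded_index (H : set M) : Prop := small K (lcosets H).

Definition type_definable (B H : set M) : Prop :=
  exists p : set (pform B), H = [set x | forall phi, p phi -> psat phi x].

Definition aut_invariant (B H : set M) : Prop :=
  forall g : M -> M, automorphism g -> (forall b, B b -> g b = b) ->
    g @` H = H.

Definition smallest (C : set (set M)) (H : set M) : Prop :=
  C H /\ forall H', C H' -> H `<=` H'.

Definition is_component00 (B H : set M) : Prop :=
  smallest [set H' | [/\ subgroup H', bounded_index H' & type_definable B H']] H.

Definition is_component000 (B H : set M) : Prop :=
  smallest [set H' | [/\ subgroup H', bounded_index H' & aut_invariant B H']] H.

End Monster.

Definition monster (K P : Type) (F M : structure P) (iota : F -> M) : Prop :=
  [/\ sufficiently_large K P, elementary_embedding iota,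
      saturated K M & strongly_homogeneous K M].

(* Main.v *)
Require Import Defs.
From mathcomp Require Import all_boot ssralg ssrnum ssrint intdiv zify.
From mathcomp Require Import boolp classical_sets functions cardinality.
From mathcomp Require Import filter.

Set Implicit Arguments.
Unset Strict Implicit.
Unset Printing Implicit Defensive.

Local Open Scope classical_set_scope.
Local Open Scope card_scope.

(** The types over the standard model F are the ultrafilters on F, because
every formula with parameters in F defines there a named subset. So elements x
of a monster model M carry an ultrafilter [tp x], and the facts needed about M
reduce to statements about F that pass to M by elementarity.

Let H be a subgroup of M of bounded index which is invariant under all
automorphisms. If a and b have the same type then a^-1 b lies in H
([invariant_same_type]): choose a small set R of representatives, realizing tp
a, of the cosets of H which meet the realizations of tp a; a coheir c of tp a
over R is in the coset of some r in R; the type of the pair (r, c) depends on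
tp a only, so by homogeneity a coheir c' over {a, b} is in the cosets of a and
of b. Conversely, a subgroup containing all these quotients has index at most
the number of ultrafilters on F ([bounded_same_type]). Hence intersections of
such subgroups H still have bounded index, which gives both components; as the
elements of F are definable without parameters, working over F or over the
empty set makes no difference.

To separate the components, let q be the Brooks quasimorphism of the free group
counting the occurrences of x1 x2 minus those of its inverse. The elements of M
whose value of q is, for some standard C and all standard N > 0, within C of a
multiple of N form an invariant subgroup [q_subgroup] of bounded index, so it
contains the 000-component. The 00-component contains a nonstandard positive
power a of x1 and one b of x2, since bounded index forces a collision among the
nonstandard powers ([bounded_index_power]); hence it contains (ab)^j, on which
q takes the value j, for every standard j. As the 00-component is
type-definable, saturation yields an element x of it for which q is congruent
to 1 + 4 + ... + 4^(k-1) modulo 4^k for all k at once. These residues stay away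
from the multiples of 4^k by more and more, so x is not in [q_subgroup]. *)

(** * A geometric sequence far from zero modulo the powers of 4 *)

Definition geom4 (k : nat) : nat := \sum_(i < k) 4 ^ i.

Lemma geom4S k : geom4 k.+1 = (geom4 k + 4 ^ k)%N.
Proof. by rewrite /geom4 big_ord_recr. Qed.

Lemma geom4E k : (3 * geom4 k + 1 = 4 ^ k)%N.
Proof.
elim: k => [|k IH]; first by rewrite /geom4 big_ord0.
rewrite geom4S expnS; lia.
Qed.

Lemma geom4_ge k : (k <= geom4 k)%N.
Proof.
elim: k => [|k IH] //; rewrite geom4S; have := expn_gt0 4 k; lia.
Qed.

Lemma geom4_mod k j : (k <= j)%N ->
  exists n, geom4 j = (geom4 k + n * 4 ^ k)%N.
Proof.
move=> /subnK <-; elim: (j - k)%N => [|d [n IH]].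
  by exists 0%N; rewrite add0n; lia.
exists (n + 4 ^ d)%N; rewrite addSn geom4S IH expnD; lia.
Qed.

(** * The Brooks quasimorphism of a free group *)

Section Counting.
Variables (m : nat) (i1 i2 : 'I_m).

Implicit Types (x y : letter m) (u v w : seq (letter m)).

(** The word x1 x2 gets weight 1 and its inverse x2^-1 x1^-1 weight -1, so that
the sum over consecutive letters counts the occurrences of the former minus
those of the latter. *)
Definition pair_weight x y : int :=
  (((x == (i1, true)) && (y == (i2, true)))%:Z -
   ((x == (i2, false)) && (y == (i1, false)))%:Z)%R.

Fixpoint signed_count w : int :=
  if w is x :: w' then
    (oapp (pair_weight x) 0 (ohead w') + signed_count w')%R
  else 0%R.

Lemma pair_weight_inv x y :
  pair_weight (letter_inv y) (letter_inv x) = (- pair_weight x y)%R.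
Proof.
case: x y => [i [|]] [j [|]];
  rewrite /pair_weight /letter_inv /= !xpair_eqE /= ?andbF ?andbT /=;
  by rewrite ?[(j == _) && _]andbC //; lia.
Qed.

Lemma pair_weight_le1 x y : (`|pair_weight x y| <= 1)%R.
Proof.
rewrite /pair_weight; case: (x == _); case: (y == _); case: (x == _);
  case: (y == _) => //=.
Qed.

Lemma signed_count_cat u v : exists e : int, (`|e| <= 1)%R /\
  signed_count (u ++ v) = (signed_count u + signed_count v + e)%R.
Proof.
elim: u => [|x u [e [e1 IH]]]; first by exists 0%R; split=> //=; lia.
case: u IH => [|y u] IH; last first.
  by exists e; split=> //; rewrite cat_cons /= in IH *; lia.
exists (oapp (pair_weight x) 0%R (ohead v)); split; last by rewrite /=; lia.
by case: v {IH} => //= y v; exact: pair_weight_le1.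
Qed.

Lemma signed_count_rcons u x y :
  signed_count (rcons (rcons u x) y) =
    (signed_count (rcons u x) + pair_weight x y)%R.
Proof.
elim: u => [|z u IH] /=; first lia.
rewrite IH; case: u {IH} => //= *; lia.
Qed.

Lemma signed_count_inv w : signed_count (word_inv w) = (- signed_count w)%R.
Proof.
rewrite /word_inv; elim: w => [|x [|y w] IH] //.
have -> : rev (map (@letter_inv m) [:: x, y & w]) =
    rcons (rcons (rev (map (@letter_inv m) w)) (letter_inv y)) (letter_inv x).
  by rewrite !map_cons !rev_cons.
rewrite signed_count_rcons -rev_cons -map_cons IH pair_weight_inv /=; lia.
Qed.

Lemma word_mul_cancel u v : reduced u -> reduced v ->
  exists p z s, [/\ u = p ++ z, v = word_inv z ++ s & word_mul u v = p ++ s].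
Proof.
elim: u => [|x u IH] ru rv; first by exists [::], [::], v.
have [|p [z [s [uE vE mE]]]] := IH _ rv; first exact: path_sorted ru.
case: p uE mE => [/= uz|y p uE] mE; last first.
  exists [:: x, y & p], z, s; split=> //; first by rewrite uE.
  by rewrite /= mE /=; move: ru; rewrite uE /= => /andP[/negPf ->].
case: s vE mE => [|y s] vE mE.
  by exists [:: x], z, [::]; rewrite /= mE uz.
rewrite /= mE /= uz; case: ifPn => [/eqP yx|_]; last first.
  by exists [:: x], z, (y :: s).
exists [::], (x :: z), s; split=> //.
by rewrite vE /word_inv /= rev_cons yx -cats1 -catA.
Qed.

Definition brooks (g : free_group m) : int := signed_count g.

Lemma brooks_inv g : brooks (g^-1)%g = (- brooks g)%R.
Proof. exact: signed_count_inv. Qed.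

(** After cancelling z, the words of g, h and gh are concatenations p z, z^-1 s
and p s; each concatenation costs at most 1, and the contributions of z and
z^-1 cancel. *)
Lemma brooks_mul (g h : free_group m) :
  (`|brooks (g * h)%g - brooks g - brooks h| <= 3)%R.
Proof.
have [p [z [s [gE hE ghE]]]] := word_mul_cancel (fg_reduced g) (fg_reduced h).
have -> : brooks (g * h)%g = signed_count (p ++ s) by rewrite -ghE.
rewrite /brooks gE hE.
have [e1 [e1P ->]] := signed_count_cat p s.
have [e2 [e2P ->]] := signed_count_cat p z.
have [e3 [e3P ->]] := signed_count_cat (word_inv z) s.
rewrite signed_count_inv; lia.
Qed.

Lemma positive_word_mul u v : all snd u -> all snd v -> word_mul u v = u ++ v.
Proof.
move=> + vpos; elim: u => //= -[i b] u IH /andP[/= -> upos]; rewrite IH //.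
have : all snd (u ++ v) by rewrite all_cat upos.
case: (u ++ v) => //= -[k c] w /andP[/= -> _].
by rewrite /letter_inv xpair_eqE /= andbF.
Qed.

Lemma reduced_gen i : reduced [:: (i, true) : letter m].
Proof. by []. Qed.

Definition gen (i : 'I_m) : free_group m := FreeGroup (reduced_gen i).

Lemma gen_exp i n : (gen i ^+ n)%g = nseq n (i, true) :> seq (letter m).
Proof.
elim: n => [|n IH]; first by rewrite expg0.
rewrite expgS /= IH /=; case: n {IH} => //= n.
by rewrite /letter_inv xpair_eqE /= andbF.
Qed.

Lemma gen_exp_inj i : injective (fun n => gen i ^+ n)%g.
Proof.
move=> n k /(congr1 (size \o @fg_word m)).
by rewrite /= !gen_exp !size_nseq.
Qed.

Lemma pair_weight_same x : i1 != i2 -> pair_weight x x = 0%R.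
Proof.
move=> i12; case: x => i [|]; rewrite /pair_weight !xpair_eqE /= ?andbF ?andbT.
  by case: eqP => [->|] //=; rewrite (negPf i12).
by case: eqP => [->|] //=; rewrite eq_sym (negPf i12).
Qed.

Lemma signed_count_nseq n x w : i1 != i2 -> signed_count (nseq n.+1 x ++ w) =
  (oapp (pair_weight x) 0 (ohead w) + signed_count w)%R.
Proof.
move=> i12; elim: n => [|n IH] //.
rewrite -[LHS]/(pair_weight x x + signed_count (nseq n.+1 x ++ w))%R IH.
by rewrite pair_weight_same //; lia.
Qed.

(** Each block contains x1 x2 once, and x2 x1 at the junctions has weight 0. *)
Lemma brooks_powers n k j : i1 != i2 ->
  brooks (iter j ( *%g (gen i1 ^+ n.+1 * gen i2 ^+ k.+1)) 1)%g = Posz j.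
Proof.
move=> i12; set u := (_ * _)%g.
have uE : u = nseq n.+1 (i1, true) ++ nseq k.+1 (i2, true) :> seq (letter m).
  by rewrite -!gen_exp -positive_word_mul // gen_exp all_nseq orbT.
suff : [/\ brooks (iter j ( *%g u) 1)%g = Posz j, all snd (iter j ( *%g u) 1)%g
  & ohead (iter j ( *%g u) 1)%g = if j == 0 then None else Some (i1, true)].
  by case.
elim: j => [|j [IHc IHp IHh]] //; rewrite !iterS.
set w := iter j _ _ in IHc IHp IHh *.
have wE : (u * w)%g = nseq n.+1 (i1, true) ++ nseq k.+1 (i2, true) ++ w
    :> seq (letter m).
  by rewrite catA -uE -positive_word_mul // uE all_cat !all_nseq !orbT.
rewrite wE; split=> //; last by rewrite !all_cat !all_nseq !orbT.
rewrite /brooks wE !signed_count_nseq // IHh -/(brooks w) IHc /= /pair_weight.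
rewrite !eqxx !xpair_eqE /= !andbF [i2 == i1]eq_sym (negPf i12) /=.
by case: eqP => _ /=; lia.
Qed.

End Counting.

(** * Renaming of variables and transfer *)

Section Syntax.
Variable P : Type.

Lemma scons0 (M : structure P) n (x : M) (v : 'I_n -> M) : scons x v ord0 = x.
Proof. by rewrite /scons unlift_none. Qed.

Lemma scons_lift (M : structure P) n (x : M) (v : 'I_n -> M) i :
  scons x v (lift ord0 i) = v i.
Proof. by rewrite /scons liftK. Qed.

Lemma scons_eta (M : structure P) n (v : 'I_n.+1 -> M) :
  scons (v ord0) (v \o lift ord0) = v.
Proof.
by apply/funext => i; case: (unliftP ord0 i) => [j|] ->;
   rewrite ?scons0 ?scons_lift.
Qed.

Lemma comp_scons (M N : structure P) (f : M -> N) n (x : M) (v : 'I_n -> M) :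
  f \o scons x v = scons (f x) (f \o v).
Proof. by apply/funext => i; rewrite /= /scons; case: unlift. Qed.

Fixpoint trename n k (r : 'I_n -> 'I_k) (t : term n) : term k :=
  match t with
  | tvar i => tvar (r i)
  | tone => tone
  | tmul t1 t2 => tmul (trename r t1) (trename r t2)
  | tinv t1 => tinv (trename r t1)
  end.

Definition rename_under n k (r : 'I_n -> 'I_k) : 'I_n.+1 -> 'I_k.+1 :=
  fun i => oapp (lift ord0 \o r) ord0 (unlift ord0 i).

Fixpoint rename n (phi : form P n) k (r : 'I_n -> 'I_k) : form P k :=
  match phi with
  | fbot => fbot
  | feq t1 t2 => feq (trename r t1) (trename r t2)
  | fpred A t => fpred A (trename r t)
  | fimp phi1 phi2 => fimp (rename phi1 r) (rename phi2 r)
  | fall phi1 => fall (rename phi1 (rename_under r))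
  end.

Lemma teval_rename (M : structure P) n k (r : 'I_n -> 'I_k) (v : 'I_k -> M) t :
  teval v (trename r t) = teval (v \o r) t.
Proof. by elim: t => //= [t1 -> t2 ->|t1 ->]. Qed.

Lemma sat_rename (M : structure P) n (phi : form P n) k (r : 'I_n -> 'I_k)
    (v : 'I_k -> M) :
  sat (rename phi r) v <-> sat phi (v \o r).
Proof.
elim: phi k r v => {n} [n|n t1 t2|n A t|n f1 IH1 f2 IH2|n f1 IH1] k r v //=.
- by rewrite !teval_rename.
- by rewrite teval_rename.
- by rewrite IH1 IH2.
split=> fP x.
  have /IH1 := fP x; congr (sat _ _); apply/funext => i /=.
  rewrite /rename_under /scons; case: (unlift ord0 i) => [j|] /=;
  by rewrite ?liftK ?unlift_none.
apply/IH1; have := fP x; congr (sat _ _); apply/funext => i /=.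
by rewrite /rename_under /scons; case: (unlift ord0 i) => [j|] /=;
   rewrite ?liftK ?unlift_none.
Qed.

End Syntax.

Lemma filter_bigcap_finite T (U : set_system T) {FU : Filter U} I (q : set I)
    (S : I -> set T) :
  finite_set q -> (forall i, q i -> U (S i)) -> U (\bigcap_(i in q) S i).
Proof.
elim/Pchoice: I => I in q S *.
move=> /finite_fsetP[X ->] qS; apply: filter_bigI => i iX; exact: qS.
Qed.

(** Elementarity speaks of valuations in the image of iota; a formula valid in
F is valid at all valuations in M because its universal closure is a sentence.
*)
Lemma transfer P (F M : structure P) (iota : F -> M) n (phi : form P n) :
  elementary_embedding iota ->
  (forall v : 'I_n -> F, sat phi v) -> forall v : 'I_n -> M, sat phi v.
Proof.
move=> el; elim: n phi => [|n IH] phi phiF v.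
  have v0 : 'I_0 -> F by case.
  have /(el _ phi) := phiF v0; congr (sat _ _).
  by apply/funext => -[].
have phiP : forall v : 'I_n -> F, sat (fall phi) v by move=> v' x; exact: phiF.
by have := IH _ phiP (v \o lift ord0) (v ord0); rewrite scons_eta.
Qed.

(** * Named sets in an elementary extension of the standard model *)

Section StandardModel.
Variables (G : groupType).
Let F := all_subsets_expansion G.
Variables (M : structure (set G)) (iota : F -> M).
Hypothesis iota_el : elementary_embedding iota.

Local Notation var0 := (tvar ord0).
Local Notation var1 := (tvar (lift ord0 ord0)).
Local Notation var2 := (tvar (lift ord0 (lift ord0 ord0))).
Let vals (n : nat) (s : seq M) : 'I_n -> M := fun i => nth sone s i.

Let transferM n (phi : form (set G) n) := @transfer _ F M iota n phi iota_el.

Implicit Types (A B C : set G) (x y z : M).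

Lemma sub_spred A B x : A `<=` B -> spred A x -> spred B x.
Proof.
move=> AB; have := @transferM 1 (fimp (fpred A var0) (fpred B var0)).
by move=> /(_ (fun v => AB _) (vals [:: x])).
Qed.

Lemma spredI A B x : spred A x -> spred B x -> spred (A `&` B) x.
Proof.
have := @transferM 1
  (fimp (fpred A var0) (fimp (fpred B var0) (fpred (A `&` B) var0))).
by move=> /(_ (fun v => @conj _ _) (vals [:: x])).
Qed.

Lemma spredT x : spred setT x.
Proof.
have := @transferM 1 (fpred setT var0).
by move=> /(_ (fun v => I) (vals [:: x])).
Qed.

Lemma spred0 x : ~ spred set0 x.
Proof.
have := @transferM 1 (fimp (fpred set0 var0) fbot).
by move=> /(_ (fun v => id) (vals [:: x])).
Qed.

Lemma spredU A B x : spred (A `|` B) x -> spred A x \/ spred B x.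
Proof.
have := @transferM 1 (fimp (fpred (A `|` B) var0)
  (fimp (fimp (fpred A var0) fbot) (fpred B var0))).
have ABP : forall g, (A `|` B) g -> (A g -> False) -> B g.
  by move=> g [].
move=> /(_ (fun v => @ABP _) (vals [:: x])) /= AB ABx.
by have [Ax|nAx] := pselect (spred A x); [left|right; exact: AB].
Qed.

Lemma spredC A x : spred (~` A) x <-> ~ spred A x.
Proof.
split=> [nA Ax|nAx].
  by apply: (@spred0 x); rewrite -(setICl A); exact: spredI.
have := spredT x; rewrite -(setUv A) => /spredU[] //.
Qed.

Lemma spred_mul A B C x y :
  (forall g h : G, A g -> B h -> C (g * h)%g) ->
  spred A x -> spred B y -> spred C (smul x y).
Proof.
move=> ABC; have := @transferM 2
  (fimp (fpred A var0) (fimp (fpred B var1) (fpred C (tmul var0 var1)))).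
by move=> /(_ (fun v => ABC _ _) (vals [:: x; y])).
Qed.

Lemma spred_inv A B x :
  (forall g : G, A g -> B (g^-1)%g) -> spred A x -> spred B (sinv x).
Proof.
move=> AB; have := @transferM 1
  (fimp (fpred A var0) (fpred B (tinv var0))).
by move=> /(_ (fun v => AB _) (vals [:: x])).
Qed.

Lemma spred_iter (A B : set G) j x :
  (forall g : G, A g -> B (iter j ( *%g g) 1%g)) ->
  spred A x -> spred B (iter j (smul x) sone).
Proof.
pose tpow n (t : term n) := iter j (tmul t) tone.
have tpowE (N : structure (set G)) n (v : 'I_n -> N) t :
    teval v (tpow n t) = iter j (smul (teval v t)) sone.
  by rewrite /tpow; elim: (j) => //= i ->.
move=> AB Ax; have := @transferM 1
  (fimp (fpred A var0) (fpred B (tpow _ var0))).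
move=> /(_ _ (fun=> x)) /=; rewrite tpowE; apply=> // v /=; rewrite tpowE.
exact: AB.
Qed.

Lemma spred_one A : spred A (sone : M) <-> A 1%g.
Proof.
have v0 : 'I_0 -> F by case.
exact: iff_sym (iota_el (fpred A tone) v0).
Qed.

Lemma smulA x y z : smul x (smul y z) = smul (smul x y) z.
Proof.
have := @transferM 3
  (feq (tmul var0 (tmul var1 var2)) (tmul (tmul var0 var1) var2)).
by move=> /(_ (fun v => mulgA _ _ _) (vals [:: x; y; z])).
Qed.

Lemma smul1 x : smul sone x = x.
Proof.
have := @transferM 1 (feq (tmul tone var0) var0).
by move=> /(_ (fun v => mul1g _) (vals [:: x])).
Qed.

Lemma smulg1 x : smul x sone = x.
Proof.
have := @transferM 1 (feq (tmul var0 tone) var0).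
by move=> /(_ (fun v => mulg1 _) (vals [:: x])).
Qed.

Lemma smulV x : smul (sinv x) x = sone.
Proof.
have := @transferM 1 (feq (tmul (tinv var0) var0) tone).
by move=> /(_ (fun v => mulVg _) (vals [:: x])).
Qed.

Lemma smulKV x y : smul (sinv x) (smul x y) = y.
Proof. by rewrite smulA smulV smul1. Qed.

Lemma smulVK x y : smul x (smul (sinv x) y) = y.
Proof.
have := @transferM 2 (feq (tmul var0 (tmul (tinv var0) var1)) var1).
by move=> /(_ (fun v => mulVKg _ _) (vals [:: x; y])).
Qed.

Lemma smul_eq1 x y : smul (sinv x) y = sone -> x = y.
Proof.
have := @transferM 2 (fimp (feq (tmul (tinv var0) var1) tone) (feq var0 var1)).
have eqP' (g h : G) : (g^-1 * h = 1 -> g = h)%g.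
  by move=> e; rewrite -[RHS](mulVKg g) e mulg1.
by move=> /(_ (fun v => @eqP' _ _) (vals [:: x; y])).
Qed.

Lemma spred_iota A (g : G) : spred A (iota g) <-> A g.
Proof. by have /= -> := iota_el (fpred A var0) (fun _ : 'I_1 => g). Qed.

Lemma iota_inj : injective iota.
Proof.
move=> g h gh; have : spred [set h] (iota g) by rewrite gh; apply/spred_iota.
by move/spred_iota.
Qed.

(** A formula with standard parameters is equivalent in F to the predicate
naming its solution set, and this equivalence is a formula with the same
parameters. *)
Lemma definable_pred n (phi : form (set G) n.+1) (u : 'I_n -> F) :
  exists A, forall x, sat phi (scons x (iota \o u)) <-> spred A x.
Proof.
pose A : set G := [set g | sat phi (scons (g : F) u)].
exists A => x; split.
  have := iota_el (fall (fimp phi (fpred A var0))) u.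
  move=> /= -[+ _] => /(_ _ x); rewrite scons0; apply=> g.
  by rewrite scons0.
have := iota_el (fall (fimp (fpred A var0) phi)) u.
move=> /= -[+ _] => /(_ _ x); rewrite scons0; apply=> g.
by rewrite scons0.
Qed.

Lemma spred_set1 (g : G) x : spred [set g] x <-> x = iota g.
Proof.
split=> [|->]; last exact/spred_iota.
have := iota_el (fall (fimp (fpred [set g] var0) (feq var0 var1)))
          (fun _ : 'I_1 => g).
rewrite /= => -[+ _] => /(_ _ x); rewrite scons0 scons_lift; apply=> h.
by rewrite scons0 scons_lift.
Qed.

End StandardModel.

(** * Small sets and realization of types *)

Section SmallSets.
Variable K : Type.

Lemma small_le T U (A : set T) (B : set U) : A #<= B -> small K B -> small K A.
Proof.
move=> AB [BK KB]; split; first exact: card_le_trans AB BK.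
by move=> KA; apply: KB; exact: card_le_trans KA AB.
Qed.

Lemma inj_card_leT (T U : Type) (f : T -> U) :
  injective f -> [set: T] #<= [set: U].
Proof.
move=> f_inj; rewrite -[setT]/(f @^-1` setT); apply: card_ge_preimage.
by move=> x y _ _; exact: f_inj.
Qed.

Variable P : Type.
Hypothesis Klarge : sufficiently_large K P.

Lemma countable_small T (A : set T) : countable A -> small K A.
Proof.
move=> A0; apply: small_le Klarge; apply: card_le_trans A0 _.
pose nthL n : set {n : nat & form P n} := [set existT _ n fbot].
apply: (@inj_card_leT _ _ nthL) => i j ij.
have : nthL j (existT _ i fbot) by rewrite -ij.
by case.
Qed.

Lemma small_types : small K [set: set P].
Proof.
apply: small_le Klarge.
pose preds (Q : set P) : set {n : nat & form P n} :=
  [set existT _ 0%N (fpred A tone) | A in Q].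
pose symbol (s : {n : nat & form P n}) :=
  match projT2 s with fpred A _ => Some A | _ => None end.
pose symbols L : set P := [set A | exists2 s, L s & symbol s = Some A].
apply: (@inj_card_leT _ _ preds); apply: (can_inj (g := symbols)) => Q.
apply/seteqP; split=> [A [_ [B QB <-]] [<-//]|A QA].
by exists (existT _ 0%N (fpred A tone)); first exists A.
Qed.

End SmallSets.

Section Saturated.
Variables (K P : Type) (M : structure P).
Hypothesis Msat : saturated K M.

(** Finite satisfiability is most easily witnessed along a proper filter. It is
used for an ultrafilter on the standard model and for sequences. *)
Lemma realize_filter (B : set M) (p : set (pform B)) T (U : set_system T)
    {FU : ProperFilter U} (y : T -> M) :
  small K B -> (forall phi, p phi -> U [set t | psat phi (y t)]) ->
  exists x, forall phi, p phi -> psat phi x.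
Proof.
move=> smallB pU; apply: Msat => // q qfin qp.
have /filter_ex[t qt] : U (\bigcap_(phi in q) [set t | psat phi (y t)]).
  by apply: filter_bigcap_finite => // phi /qp; exact: pU.
by exists (y t) => phi /qt.
Qed.

End Saturated.

(** * Coheirs and invariant subgroups of bounded index *)

Section Monster.
Variables (G : groupType).
Let F := all_subsets_expansion G.
Variables (K : Type) (M : structure (set G)) (iota : F -> M).
Hypothesis Mmonster : monster K iota.

Local Notation var0 := (tvar ord0).
Local Notation var1 := (tvar (lift ord0 ord0)).

Let Klarge : sufficiently_large K (set G). Proof. by case: Mmonster. Qed.
Let iota_el : elementary_embedding iota. Proof. by case: Mmonster. Qed.
Let Msat : saturated K M. Proof. by case: Mmonster. Qed.
Let Mhom : strongly_homogeneous K M. Proof. by case: Mmonster. Qed.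

Implicit Types (x y z a b : M) (H : set M).

(** Recording the predicates only loses nothing: see [pform_pred]. *)
Definition tp x : set_system G := [set A | spred A x].

Instance tp_filter x : ProperFilter (tp x).
Proof.
apply: Build_ProperFilter; first exact: (@spred0 _ _ _ iota_el x).
split; first exact: (spredT iota_el).
  by move=> A B; exact: (spredI iota_el).
by move=> A B; exact: (sub_spred iota_el).
Qed.

(** The filter tp a on the standard model decides the formulas with parameters
in B, and thus extends tp a to a type over B. *)
Definition is_coheir a (B : set M) c : Prop :=
  forall n (phi : form (set G) n.+1) (v : 'I_n -> M), (forall i, B (v i)) ->
    sat phi (scons c v) <-> spred [set g | sat phi (scons (iota g) v)] a.

Lemma coheir_exists a (B : set M) : small K B -> exists c, is_coheir a B c.
Proof.
move=> smallB; pose p := [set phi : pform B | tp a [set g | psat phi (iota g)]].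
have [c cP] := @realize_filter _ _ _ Msat B p _ (tp a) _ iota smallB (fun=> id).
exists c => n phi v Bv; split=> [phic|]; last exact: (cP (PForm phi Bv)).
apply: contrapT => /(spredC iota_el) nphi.
exact: (cP (PForm (fimp phi fbot) Bv)).
Qed.

Lemma coheir_tp a (B : set M) c : is_coheir a B c -> tp c = tp a.
Proof.
move=> cP; apply/funext => A; apply/propext; rewrite /tp /=.
have v0 : 'I_0 -> M by case.
have := cP 0%N (fpred A var0) v0; rewrite /= !scons0 => ->; last by case.
suff -> : [set g | spred A (scons (iota g) v0 ord0)] = A by [].
by apply/funext => g; apply/propext; rewrite /= scons0; exact: spred_iota.
Qed.

(** phi(c, b) holds iff phi(g, b) holds for tp a-almost all standard g, and for
each such g the truth of phi(g, b) is decided by tp b. *)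
Lemma coheir_pair_type a (B B' : set M) b b' c c' (phi : form (set G) 2) :
  is_coheir a B c -> is_coheir a B' c' -> B b -> B' b' -> tp b = tp b' ->
  sat phi (scons c (fun=> b)) <-> sat phi (scons c' (fun=> b')).
Proof.
move=> cP c'P Bb Bb' bb'; rewrite (cP _ _ _ (fun=> Bb)) (c'P _ _ _ (fun=> Bb')).
suff eqphi g : sat phi (scons (iota g) (fun=> b)) <->
    sat phi (scons (iota g) (fun=> b')).
  by split; apply: (sub_spred iota_el) => g /eqphi.
(* The parameter of phi must come last for phi(g, y) to define a set of y. *)
pose swap (i : 'I_2) : 'I_2 := if i == ord0 then lift ord0 ord0 else ord0.
have swapP y : sat phi (scons (iota g) (fun=> y)) <->
    sat (rename phi swap) (scons y (iota \o (fun=> g))).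
  rewrite sat_rename; set v := scons _ _; set w := _ \o _.
  suff -> : v = w by [].
  apply/funext => i; rewrite /v /w /swap /=.
  case: (unliftP ord0 i) => [j ->|->]; last by rewrite eqxx scons_lift scons0.
  by rewrite scons_lift /= scons0.
have [A AP] := definable_pred iota_el (rename phi swap) (fun _ : 'I_1 => g).
by rewrite !swapP !AP -[spred A b]/(tp b A) bb'.
Qed.

Definition coset H x : set M := [set smul x h | h in H].

Lemma coset_eqP H x y :
  subgroup H -> coset H x = coset H y <-> H (smul (sinv x) y).
Proof.
move=> [H1 Hmul Hinv]; split=> [eqxy|Hxy].
  have : coset H y y by exists sone => //; exact: (smulg1 iota_el).
  by rewrite -eqxy => -[h Hh <-]; rewrite (smulKV iota_el).
apply/seteqP; split=> [_ [h Hh <-]|_ [h Hh <-]].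
  exists (smul (sinv (smul (sinv x) y)) h); first exact/Hmul/Hh/Hinv.
  by rewrite -{1}(smulVK iota_el x y) -(smulA iota_el) (smulVK iota_el).
exists (smul (smul (sinv x) y) h); first exact: Hmul.
by rewrite -(smulA iota_el) (smulVK iota_el).
Qed.

(** Because the representatives lie in Q, an element of Q chosen generic over
the small set R still shares its coset with an element of Q in R; this replaces
indiscernible sequences longer than the index. *)
Lemma small_reps H (Q : set M) : bounded_index K H ->
  exists R, [/\ small K R, R `<=` Q &
    forall y, Q y -> exists2 r, R r & coset H r = coset H y].
Proof.
move=> Hbnd.
have /choice[rep repP] : forall C : set M, exists x,
    (exists2 y, Q y & coset H y = C) -> Q x /\ coset H x = C.
  move=> C; have [[y Qy yC]|nC] := pselect (exists2 y, Q y & coset H y = C).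
    by exists y.
  by exists sone => /nC.
exists (Q `&` (rep @` lcosets H)); split; last 2 first.
- by move=> x [].
- move=> y Qy; have [] := repP (coset H y); first by exists y.
  move=> Qr eqr; exists (rep (coset H y)) => //; split=> //.
  by exists (coset H y) => //; exists y.
apply: small_le Hbnd; apply: card_le_trans (card_image_le rep _).
by apply: subset_card_le; exact: subIsetr.
Qed.

(** Homogeneity is about partial elementary maps, that is about valuations of
any length in {b, c}; these reduce to the pair (c, b) by renaming variables. *)
Lemma pair_homogeneous b b' c c' :
  (forall phi : form (set G) 2,
    sat phi (scons c (fun=> b)) <-> sat phi (scons c' (fun=> b'))) ->
  exists2 g : M -> M, automorphism g & g b = b' /\ g c = c'.
Proof.
move=> eqt; pose f x := if pselect (x = c) then c' else b'.
have fb : f b = b'.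
  rewrite /f; case: pselect => // bc.
  have /= := eqt (feq var0 var1); rewrite !scons0 !scons_lift => -[+ _].
  exact.
have fc : f c = c' by rewrite /f; case: pselect.
have [||g gaut gf] := @Mhom [set b; c] f.
- by apply: (countable_small Klarge); exact: finite_set_countable.
- move=> n phi v vbc.
  pose r (i : 'I_n) : 'I_2 :=
    if pselect (v i = c) then ord0 else lift ord0 ord0.
  have vE : v = scons c (fun=> b) \o r.
    apply/funext => i; rewrite /= /r; case: pselect => [vi|nc].
      by rewrite scons0.
    by rewrite scons_lift; case: (vbc i).
  have fvE : f \o v = scons c' (fun=> b') \o r.
    by rewrite [in LHS]vE compA comp_scons fc; congr (scons _ _ \o r);
      apply/funext.
  by rewrite fvE vE -!sat_rename; exact: eqt.
- by exists g => //; split; rewrite gf //=; [left|right].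
Qed.

(** A coheir c of tp a over a small set R of representatives shares its coset
with some r in R. By homogeneity so do c' and d, for every d of the same type
and every coheir c' over a set containing d; take d = a and d = b. *)
Lemma invariant_same_type H a b :
  subgroup H -> bounded_index K H -> aut_invariant set0 H -> tp a = tp b ->
  H (smul (sinv a) b).
Proof.
move=> Hsub Hbnd Hinv ab.
have [R [smallR Ra Rcov]] := @small_reps H [set x | tp x = tp a] Hbnd.
have [c cP] := coheir_exists a smallR.
have [r Rr rc] := Rcov c (coheir_tp cP).
have /(coheir_exists a)[c' c'P] : small K [set a; b].
  by apply: (countable_small Klarge); exact: finite_set_countable.
have Hc' d : [set a; b] d -> coset H d = coset H c'.
  move=> abd; have rd : tp r = tp d by rewrite Ra //; case: abd => -> //.
  have /pair_homogeneous[g gaut [gr gc]] phi :=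
    coheir_pair_type phi cP c'P Rr abd rd.
  apply/coset_eqP => //.
  have gH := Hinv g gaut (fun _ => False_ind _).
  rewrite -gr -gc -gH; exists (smul (sinv r) c); first exact/coset_eqP.
  by case: gaut => _ _ gM gV _; rewrite gM gV.
by apply/coset_eqP; rewrite ?(Hc' a) ?(Hc' b) //; [right|left].
Qed.

(** The cosets are indexed by the types. *)
Lemma bounded_same_type H :
  subgroup H -> (forall a b, tp a = tp b -> H (smul (sinv a) b)) ->
  bounded_index K H.
Proof.
move=> Hsub Htp; apply: small_le (small_types Klarge).
have /choice[pick pickP] : forall t : set (set G), exists x,
    (exists y, tp y = t) -> tp x = t.
  move=> t; have [[y yt]|nt] := pselect (exists y, tp y = t); first by exists y.
  by exists sone => /nt.
apply: card_le_trans (card_image_le (coset H \o pick) _).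
apply: subset_card_le => _ [x _ <-]; exists (tp x) => //=.
by apply/coset_eqP => //; apply: Htp; apply: pickP; exists x.
Qed.

Lemma aut_same_type g x : automorphism g -> tp (g x) = tp x.
Proof. by case=> _ _ _ _ gP; apply/funext => A; apply/propext; exact: gP. Qed.

(** * Existence of the components *)

Lemma pform_pred (B : set M) (phi : pform B) :
  B `<=` range iota -> exists A, forall x, psat phi x <-> spred A x.
Proof.
case: phi => n phi v Bv BF; rewrite /psat /=.
have /choice[u uP] : forall i : 'I_n, exists g : F, iota g = v i.
  by move=> i; have [g _ gv] := BF _ (Bv i); exists g.
have -> : v = iota \o u by apply/funext => i; rewrite /= uP.
exact: definable_pred.
Qed.

(** The number of parameters is 0, and [sone] is a dummy. *)
Definition pred_pform (B : set M) (A : set G) : pform B :=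
  @PForm _ M B 0 (fpred A var0) (fun=> sone)
    (fun i => match i with Ordinal _ p => False_ind _ (notF p) end).

Lemma psat_pred (B : set M) A x : psat (pred_pform B A) x <-> spred A x.
Proof. by rewrite /psat /= scons0. Qed.

Lemma type_definableP (B : set M) H : B `<=` range iota ->
  type_definable B H <-> exists Q : set (set G), H = [set x | Q `<=` tp x].
Proof.
move=> BF; split=> [[p ->]|[Q ->]].
  exists [set A | exists2 phi, p phi & forall x, psat phi x <-> spred A x].
  apply/seteqP; split=> x /= px => [A [phi pphi phiA]|phi pphi].
    exact/phiA/px.
  have [A AP] := pform_pred phi BF.
  by apply/AP; apply: px; exists phi.
exists [set phi | exists2 A, Q A & forall x, psat phi x <-> spred A x].
apply/seteqP; split=> x /= Qx => [phi [A QA ->]|A QA]; first exact: Qx.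
by apply/(psat_pred B A x)/Qx; exists A => // y; exact: psat_pred.
Qed.

(** Automorphisms preserve the predicates {g}, so they fix standard elements. *)
Lemma aut_invariant_standard (B : set M) H : B `<=` range iota ->
  aut_invariant B H <-> aut_invariant set0 H.
Proof.
move=> BF; split=> Hinv g gaut gB; apply: Hinv => // b /BF[h _ <-].
apply/(spred_set1 iota_el); case: gaut => _ _ _ _ ->.
exact/(spred_set1 iota_el).
Qed.

Lemma subgroup_bigcap (C : set (set M)) :
  (forall H, C H -> subgroup H) -> subgroup (\bigcap_(H in C) H).
Proof.
move=> Csub; split=> [H /Csub[]|x y Hx Hy H CH|x Hx H CH] //.
  by have [_ Hmul _] := Csub H CH; apply: Hmul; [exact: Hx|exact: Hy].
by have [_ _ Hinv] := Csub H CH; apply: Hinv; exact: Hx.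
Qed.

Definition inv_subgroups : set (set M) :=
  [set H | [/\ subgroup H, bounded_index K H & aut_invariant set0 H]].

Definition tdef_subgroups : set (set M) :=
  [set H | [/\ subgroup H, bounded_index K H & type_definable set0 H]].

Lemma type_set_invariant (Q : set (set G)) :
  aut_invariant set0 [set x : M | Q `<=` tp x].
Proof.
move=> g gaut _; apply/seteqP; split=> [_ [x Qx <-]|x Qx].
  by rewrite /= aut_same_type.
have [[h _ gh] _ _ _ _] := gaut.
by exists (h x) => //=; rewrite -(aut_same_type _ gaut) gh.
Qed.

Lemma tdef_sub_inv : tdef_subgroups `<=` inv_subgroups.
Proof.
move=> H [Hsub Hbnd /type_definableP[//|Q HQ]]; split=> //.
by rewrite HQ; exact: type_set_invariant.
Qed.

(** [invariant_same_type] passes to intersections, and it implies bounded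
index. *)
Lemma bigcap_component (C : set (set M)) : C `<=` inv_subgroups ->
  subgroup (\bigcap_(H in C) H) /\ bounded_index K (\bigcap_(H in C) H).
Proof.
move=> Cinv; have Csub : subgroup (\bigcap_(H in C) H).
  by apply: subgroup_bigcap => H /Cinv[].
split=> //; apply: bounded_same_type => // a b ab H /Cinv[Hsub Hbnd Hinv].
exact: invariant_same_type.
Qed.

Lemma component000_exists (B : set M) : B `<=` range iota ->
  is_component000 K B (\bigcap_(H in inv_subgroups) H).
Proof.
move=> BF; split; last first.
  by move=> H [Hsub Hbnd /(aut_invariant_standard _ BF) Hinv] x; apply.
have [capsub capbnd] := bigcap_component (@subset_refl _ inv_subgroups).
split=> //; apply/aut_invariant_standard => // g gaut g0.
have [[h hg gh] _ _ _ _] := gaut.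
have gH H x : inv_subgroups H -> H (g x) <-> H x.
  move=> [_ _ /(_ g gaut g0) gH]; split=> [|Hx]; last by rewrite -gH; exists x.
  by rewrite -{1}gH => -[y Hy /(can_inj hg) <-].
apply/seteqP; split=> [_ [x capx <-] H CH|x capx].
  by apply/(gH _ _ CH); exact: capx.
by exists (h x) => // H CH; apply/(gH _ _ CH); rewrite gh; exact: capx.
Qed.

Lemma component00_exists (B : set M) : B `<=` range iota ->
  is_component00 K B (\bigcap_(H in tdef_subgroups) H).
Proof.
move=> BF; split=> [|H [Hsub Hbnd /(type_definableP _ BF) Htd] x]; last first.
  by apply; split=> //; apply/type_definableP.
have [capsub capbnd] := bigcap_component tdef_sub_inv.
split=> //; apply/type_definableP => //.
exists [set A | \bigcap_(H in tdef_subgroups) H `<=` [set x | spred A x]].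
apply/seteqP; split=> [x capx A|x /= Qx H HC]; first exact.
have [_ _ /type_definableP[//|Q HQ]] := HC.
rewrite HQ => A QA; apply: Qx => y /(_ _ HC); rewrite HQ; exact.
Qed.

(** * Nonstandard powers in a subgroup of bounded index *)

(** Representatives of the cosets meeting the extension of an infinite set form
a small set, so that some c in this extension differs from all of them. *)
Lemma bounded_index_collision H (s : nat -> G) :
  subgroup H -> bounded_index K H -> injective s ->
  exists x y, [/\ spred (range s) x, spred (range s) y, x <> y &
    H (smul (sinv x) y)].
Proof.
move=> Hsub Hbnd s_inj.
have [R [smallR Rs Rcov]] := @small_reps H [set x | spred (range s) x] Hbnd.
pose p := [set phi : pform R | (forall x, psat phi x <-> spred (range s) x) \/
  exists2 r, R r & forall x, psat phi x <-> x <> r].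
have [|c cp] := @realize_filter _ _ _ Msat R p _ \oo _ (iota \o s) smallR.
  move=> phi [phiP|[r Rr phiP]].
    by exists 0%N => // n _; apply/phiP/(spred_iota iota_el); exists n.
  have [[n0 n0r]|nr] := pselect (exists n, iota (s n) = r); last first.
    by exists 0%N => // n _; apply/phiP => nr'; apply: nr; exists n.
  exists n0.+1 => // n /= n0n; apply/phiP => /=; rewrite -n0r.
  by move=> /(iota_inj iota_el)/s_inj nn0; rewrite nn0 ltnn in n0n.
have cs : spred (range s) c.
  by apply/(psat_pred R); apply: cp; left=> x; exact: psat_pred.
have [r Rr rc] := Rcov c cs.
exists r, c; split=> //; [exact: Rs| |exact/coset_eqP] => /esym.
pose ne_r := @PForm _ M R 1 (fimp (feq var0 var1) fbot) (fun=> r) (fun=> Rr).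
have ne_rP x : psat ne_r x <-> x <> r.
  by rewrite /psat /= scons0 scons_lift.
by apply/ne_rP; apply: cp; right; exists r.
Qed.

Definition pos_powers (g : G) : set G := range (fun n => g ^+ n.+1)%g.

Lemma bounded_index_power H (g : G) :
  subgroup H -> bounded_index K H -> injective (fun n => g ^+ n)%g ->
  exists2 x, H x & spred (pos_powers g) x.
Proof.
move=> Hsub Hbnd g_inj.
have [x [y [gx gy xy Hxy]]] := bounded_index_collision Hsub Hbnd g_inj.
pose inv_powers : set G := range (fun n => (g ^+ n)^-1)%g.
have igx : spred inv_powers (sinv x).
  by move: gx; apply: (spred_inv iota_el) => _ [n _ <-]; exists n.
pose neg_powers : set G := [set h | pos_powers g (h^-1)%g].
have : spred ([set 1%g] `|` pos_powers g `|` neg_powers) (smul (sinv x) y).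
  apply: (spred_mul iota_el) igx gy => _ _ [n _ <-] [k _ <-].
  case: (ltngtP n k) => nk.
  - left; right; exists (k - n).-1 => //; rewrite prednK ?subn_gt0 //.
    by rewrite -{2}(subnKC (ltnW nk)) expgnDr mulKg.
  - right; exists (n - k).-1 => //; rewrite prednK ?subn_gt0 // invgM invgK.
    by rewrite -{2}(subnKC (ltnW nk)) expgnDr mulKg.
  - by left; left; rewrite nk /= mulVg.
move=> /(spredU iota_el)[/(spredU iota_el)[|]|].
- move=> /(spred_set1 iota_el) z1; case: xy; apply: (smul_eq1 iota_el).
  by rewrite z1; apply/esym/(spred_set1 iota_el)/(spred_one iota_el).
- by exists (smul (sinv x) y).
- move=> ig; exists (sinv (smul (sinv x) y)); first by case: Hsub => _ _; exact.
  by move: ig; exact: (spred_inv iota_el).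
Qed.

(** * The invariant subgroup of a quasimorphism *)

Section Quasimorphism.
Variables (q : G -> int) (D : nat).
Hypothesis qM : forall g h : G, (`|q (g * h)%g - q g - q h| <= D%:Z)%R.
Hypothesis qV : forall g : G, q (g^-1)%g = (- q g)%R.

Definition near_multiple (N C : nat) : set G :=
  [set g | exists n : int, (`|q g - n * N%:Z| <= C%:Z)%R].

(** The bound C is uniform in N but may depend on x: products add up the
bounds. *)
Definition q_subgroup : set M :=
  [set x | exists C, forall N, (0 < N)%N -> spred (near_multiple N C) x].

Lemma subgroup_q : subgroup q_subgroup.
Proof.
split=> [|x y [C xC] [C' yC']|x [C xC]].
- exists `|q 1%g|%N => N _; apply/(spred_one iota_el); exists 0%R; lia.
- exists (C + C' + D)%N => N N0.
  apply: (spred_mul iota_el) (xC N N0) (yC' N N0).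
  move=> g h [n gn] [n' hn']; exists (n + n')%R; have := qM g h; lia.
- exists C => N N0; apply: (spred_inv iota_el) (xC N N0) => g [n gn].
  by exists (- n)%R; rewrite qV; lia.
Qed.

(** M is the union of the finitely many residue classes modulo a standard N. *)
Lemma spred_residue N x : (0 < N)%N ->
  exists r : nat, spred [set g | exists n : int, q g = (n * N%:Z + r%:Z)%R] x.
Proof.
move=> N0; pose low k : set G :=
  [set g | exists n : int, exists2 r : nat,
    (r < k)%N & q g = (n * N%:Z + r%:Z)%R].
have lowP k : spred (low k) x ->
    exists r : nat, spred [set g | exists n : int, q g = (n * N%:Z + r%:Z)%R] x.
  elim: k => [|k IH] xk.
    have /(spred0 iota_el)[] : spred set0 x.
    by apply: (sub_spred iota_el) xk => g [n []].
  pose eqk : set G := [set g | exists n : int, q g = (n * N%:Z + k%:Z)%R].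
  have : spred (low k `|` eqk) x.
    apply: (sub_spred iota_el) xk => g [n [r]].
    rewrite ltnS leq_eqVlt => /orP[/eqP->|rk] gr; first by right; exists n.
    by left; exists n, r.
  by move=> /(spredU iota_el)[/IH //|xk']; exists k.
apply: (lowP N); apply: (sub_spred iota_el) (spredT iota_el x) => g _.
have N0' : (N%:Z != 0)%R by lia.
exists (q g %/ N)%Z, `|(q g %% N)%Z|%N.
  have := ltz_mod (q g) N0'; have := modz_ge0 (q g) N0'; lia.
rewrite gez0_abs ?modz_ge0 //; exact: divz_eq.
Qed.

(** Elements of the same type have the same residue of q modulo every N. *)
Lemma q_subgroup_same_type a b : tp a = tp b -> q_subgroup (smul (sinv a) b).
Proof.
move=> ab; exists D => N N0; have [r ar] := spred_residue a N0.
pose class (s : int) := [set g | exists n : int, q g = (n * N%:Z + s)%R].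
have br : tp b (class r) by rewrite -ab.
have iar : spred (class (- r%:Z)%R) (sinv a).
  apply: (spred_inv iota_el) ar => g [n gn]; exists (- n)%R; rewrite qV gn; lia.
apply: (spred_mul iota_el) iar br => g h [n gn] [n' hn'].
exists (n + n')%R; have := qM g h; rewrite gn hn'; lia.
Qed.

Lemma inv_subgroup_q : inv_subgroups q_subgroup.
Proof.
have Hsub := subgroup_q; have Htp := q_subgroup_same_type.
split=> //; first exact: bounded_same_type.
pose nearC C := [set near_multiple N C | N in [set N | (0 < N)%N]].
suff -> : q_subgroup = \bigcup_C [set x | nearC C `<=` tp x].
  move=> g gaut g0; rewrite image_bigcup; apply: eq_bigcup => // C _.
  exact: type_set_invariant.
apply/seteqP; split=> x [C].
  by move=> xC; exists C => // _ [N N0 <-]; exact: xC.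
by move=> _ xC; exists C => N N0; apply: xC; exists N.
Qed.

Definition geom4_class (k : nat) : set G :=
  [set g | exists n : int, q g = ((geom4 k)%:Z + n * (4 ^ k)%:Z)%R].

(** As 3 (1 + 4 + ... + 4^(k-1)) = 4^k - 1, a value in the class is at distance
at least k from the multiples of 4^k. *)
Lemma geom4_class_not_q x :
  (forall k, spred (geom4_class k) x) -> ~ q_subgroup x.
Proof.
move=> xq [C xC]; pose k := C.+1.
have xk := spredI iota_el (xq k) (xC (4 ^ k)%N (expn_gt0 4 k)).
apply: (spred0 iota_el (x := x)).
apply: (sub_spred iota_el) xk => g [[n gn] [n' gn']].
have := geom4_ge k; have := geom4E k; move: gn gn'; rewrite /k.
set N := (4 ^ C.+1)%N; set s := geom4 _ => -> gn' sN Cs; exfalso.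
have {gn'} : (`|s%:Z + (n - n') * N%:Z| <= C%:Z)%R by move: gn'; lia.
have [d0|d0] := boolP (0 <= n - n')%R; nia.
Qed.

(** H contains elements c j on which q takes the standard value j; those with j
= 1 + 4 + ... + 4^(i-1) satisfy, eventually in i, each of the conditions asking
that x lies in H and that q x is in [geom4_class k]. *)
Lemma q_subgroup_separation (g h : G) :
  injective (fun n => g ^+ n)%g -> injective (fun n => h ^+ n)%g ->
  (forall n k j, q (iter j ( *%g (g ^+ n.+1 * h ^+ k.+1)) 1)%g = Posz j) ->
  forall H, tdef_subgroups H -> exists2 x, H x & ~ q_subgroup x.
Proof.
move=> g_inj h_inj qgh H [Hsub Hbnd /type_definableP[//|Q HQ]].
have [a Ha ga] := bounded_index_power Hsub Hbnd g_inj.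
have [b Hb hb] := bounded_index_power Hsub Hbnd h_inj.
pose c j := iter j (smul (smul a b)) sone.
have Hc j : H (c j).
  by case: Hsub => H1 HM _; elim: j => //= j; apply: (HM); exact: HM.
pose gh : set G := [set u | exists n k, u = g ^+ n.+1 * h ^+ k.+1]%g.
have abgh : spred gh (smul a b).
  by apply: (spred_mul iota_el) ga hb => _ _ [n _ <-] [k _ <-]; exists n, k.
have qc j : spred [set u | q u = Posz j] (c j).
  by apply: (spred_iter iota_el) abgh => _ [n [k ->]]; exact: qgh.
pose Q' := [set A | Q A \/ exists k, A = geom4_class k].
pose p := [set phi : pform (set0 : set M) |
  exists2 A, Q' A & forall x, psat phi x <-> spred A x].
have [||x xp] := @realize_filter _ _ _ Msat set0 p _ \oo _ (c \o geom4).
- exact: (countable_small Klarge).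
- move=> phi [A [QA|[k ->]] phiA].
    exists 0%N => // j _; apply/phiA.
    by have := Hc (geom4 j); rewrite HQ; exact.
  exists k => // j /= kj; apply/phiA.
  apply: (sub_spred iota_el) (qc _) => u /= qu.
  by have [n jk] := geom4_mod kj; exists (Posz n); rewrite qu jk; lia.
have xA A : Q' A -> spred A x.
  move=> QA; apply/(psat_pred set0); apply: xp.
  by exists A => // y; exact: psat_pred.
exists x; first by rewrite HQ => A QA; apply: xA; left.
by apply: geom4_class_not_q => k; apply: xA; right; exists k.
Qed.

End Quasimorphism.
End Monster.

(** * The components of the expanded free group *)

Theorem corollary4p27 (m : nat) (hm : (2 <= m)%N) (K : Type)
    (Fs : structure (set (free_group m)))
    (iota : all_subsets_expansion (free_group m) -> Fs)
    (hFs : monster K iota) :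
  exists F000_F F000_0 F00_0 F00_F : set Fs,
    [/\ is_component000 K (range iota) F000_F,
        is_component000 K set0 F000_0,
        is_component00 K set0 F00_0 &
        is_component00 K (range iota) F00_F] /\
    [/\ F000_F = F000_0, F000_0 <> F00_0 & F00_0 = F00_F].
Proof.
pose F000 := \bigcap_(H in @inv_subgroups _ K Fs) H.
pose F00 := \bigcap_(H in @tdef_subgroups _ K Fs) H.
have is000 B : B `<=` range iota -> is_component000 K B F000.
  exact: component000_exists hFs _.
have is00 B : B `<=` range iota -> is_component00 K B F00.
  exact: component00_exists hFs _.
exists F000, F000, F00, F00; split.
  by split; [exact: is000|exact: is000|exact: is00|exact: is00].
split=> //.
pose i1 := Ordinal (leq_trans (isT : 0 < 2) hm); pose i2 := Ordinal hm.
have i12 : i1 != i2 by [].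
have q_inv := inv_subgroup_q hFs (@brooks_mul _ i1 i2) (@brooks_inv _ i1 i2).
have [F00td _] : is_component00 K set0 F00 by exact: is00.
have [x F00x xNq] := q_subgroup_separation hFs (@gen_exp_inj _ i1)
  (@gen_exp_inj _ i2) (fun n k j => brooks_powers n k j i12) F00td.
by move=> eqF; apply: xNq; move: F00x; rewrite -eqF; apply; exact: q_inv.
Qed.
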